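(* Let $p\in\mathbb Q\cap[0,1]$, let $\bar m\ge 3$ be an integer, and let $F^s$ be a positional scoring rule defined for every number $m\le\bar m$ of alternatives, given by score vectors $s^1,\dots,s^{\bar m}$ with $s^m\in\mathbb R^m$. Score vectors are understood up to equivalence. (i) If $\bar m=3$, then $F^s$ satisfies $p$-Clone Resistance if and only if one of the following holds: $F^s$ is the Trivial rule; or $p>1/2$ and $F^s$ uses $s^2=(1,0)$ and $s^3=(1,1-p,0)$; or $p=1/2$ and $F^s$ uses either $s^2=(1,0)$ and $s^3=(1,\tfrac12,0)$, or $s^2=(0,1)$ and $s^3=(0,\tfrac12,1)$; or $p<1/2$ and $F^s$ uses $s^2=(0,1)$ and $s^3=(0,p,1)$. (ii) If $\bar m\ge 4$ and $p\in(0,1)$, then $F^s$ satisfies $p$-Clone Resistance if and only if $F^s$ is the Trivial rule. (iii) For every $\bar m\ge 3$: $F^s$ satisfies $1$-Clone Resistance if and only if it is the Plurality rule or the Trivial rule; and $F^s$ satisfies $0$-Clone Resistance if and only if it is the inverse Plurality rule or the Trivial rule.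
   Context: Setting. $\mathcal N$ and $\mathcal A$ are infinite sets of potential voters and potential alternatives. An electorate is a finite nonempty $N\subset\mathcal N$; an alternative set is a finite nonempty $A\subset\mathcal A$. $\mathcal L(A)$ is the set of strict linear orders on $A$. A profile is $\succ\,=(\succ_i)_{i\in N}\in\mathcal L(A)^N$. The rank of $a\in A$ for voter $i$ is $r_i(a,\succ)=1+|\{b\in A: b\succ_i a\}|$. For $B\subseteq A$, $\succ|_B$ is the profile of the restrictions of the orders $\succ_i$ to $B$. A social choice rule $F$ assigns to every profile (for every electorate $N$ and every alternative set $A$ in its domain) a nonempty set $F(\succ)\subseteq A$. Positional scoring rules. A positional scoring rule $F^s$ has, for each number $m$ of alternatives (here $1\le m\le\bar m$), a vector $s^m=(s^m_1,\dots,s^m_m)\in\mathbb R^m$ (not assumed monotone). The total score of $a\in A$ at $\succ\in\mathcal L(A)^N$ is $S_a(\succ)=\sum_{i\in N}s^{|A|}_{r_i(a,\succ)}$, and $F^s(\succ)=\{a\in A: S_a(\succ)\ge S_b(\succ)\text{ for every }b\in A\}$. Two vectors of the same dimension are equivalent if one is obtained from the other by adding a common constant to all entries and multiplying by a positive number; equivalent vectors induce the same rule, and ''uses the vector $v$'' means that the score vector is equivalent to $v$. (All vectors for $m=1$ are equivalent.) The Trivial rule uses constant vectors for every $m$ (so it always chooses all of $A$). The Plurality rule uses $(1,0,\dots,0)$ and the inverse Plurality rule uses $(0,\dots,0,1)$ for every $m\ge2$ in the domain. $p$-clone extensions. Let $p\in\mathbb Q\cap[0,1]$, $x\in A$, $x'\in\mathcal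 A\setminus A$. For $\rho\in\mathcal L(A)$ let $n_\rho(\succ)=|\{i\in N:\succ_i=\rho\}|$. A profile $\widetilde\succ\in\mathcal L(A\cup\{x'\})^N$ is a $p$-clone extension of $x$ at $\succ\in\mathcal L(A)^N$ if (1) $\widetilde\succ|_A=\succ$; (2) $|r_i(x,\widetilde\succ)-r_i(x',\widetilde\succ)|=1$ for every $i\in N$; (3) $|\{i\in N:\succ_i=\rho\text{ and }x\,\widetilde\succ_i\,x'\}|=p\,n_\rho(\succ)$ for every $\rho\in\mathcal L(A)$. (Such an extension exists only when every $p\,n_\rho(\succ)$ is an integer.) $p$-Clone Resistance. A rule $F$ satisfies $p$-Clone Resistance if for every profile $\succ$ on an alternative set $A$, every $x\in A$, and every $p$-clone extension $\widetilde\succ$ of $x$ at $\succ$, one has $F(\widetilde\succ)\cap A=F(\succ)$; for a rule defined for at most $\bar m$ alternatives this is required whenever $|A|+1\le\bar m$. *)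

(* Defs.v *)
From HB Require Import structures.
From mathcomp Require Import all_boot all_order all_algebra finmap.
From mathcomp Require Import boolp reals.

Set Implicit Arguments.
Unset Strict Implicit.
Unset Printing Implicit Defensive.

Import Order.TTheory GRing.Theory Num.Theory.
Local Open Scope ring_scope.

Definition strict_linear (T : Type) (r : rel T) : Prop :=
  [/\ irreflexive r, transitive r & forall a b, a <> b -> r a b || r b a].

(* The graph is a finite function so that the strict linear orders on a finite
   type again form a finite type with extensional equality. *)
Record linear_order (T : finType) := LinearOrder {
  lin_graph :> {ffun T * T -> bool};
  _ : `[< strict_linear (fun a b => lin_graph (a, b)) >]
}.

HB.instance Definition _ (T : finType) := [isSub for @lin_graph T].
HB.instance Definition _ (T : finType) := [Finite of linear_order T by <:].

(* prefers r a b: a is ranked strictly above b *)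
Definition prefers (T : finType) (r : linear_order T) : rel T :=
  fun a b => r (a, b).

Lemma prefers_strict_linear (T : finType) (r : linear_order T) :
  strict_linear (prefers r).
Proof. by case: r => r lin_r; apply/asboolP. Qed.

Section Restriction.
Variables (X : choiceType) (B A : {fset X}) (sBA : (B `<=` A)%fset).

Definition restrict_graph (r : linear_order A) : {ffun B * B -> bool} :=
  [ffun ab => prefers r (fincl sBA ab.1) (fincl sBA ab.2)].

Lemma restrict_graphP (r : linear_order A) :
  `[< strict_linear (fun a b => restrict_graph r (a, b)) >].
Proof.
apply/asboolP; have [irr tr tot] := prefers_strict_linear r.
split=> [a|b a c|a b neq_ab]; rewrite !ffunE /=.
- exact: irr.
- exact: tr.
- apply: tot => /(congr1 val) /= eq_ab; apply: neq_ab; exact: val_inj.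
Qed.

Definition restrict_order (r : linear_order A) : linear_order B :=
  LinearOrder (restrict_graphP r).

End Restriction.

Section Profiles.
Variables V X : choiceType.

Definition profile (N : {fset V}) (A : {fset X}) :=
  {ffun N -> linear_order A}.

Definition restrict_profile (N : {fset V}) (A B : {fset X})
    (sBA : (B `<=` A)%fset) (P : profile N A) : profile N B :=
  [ffun i => restrict_order sBA (P i)].

(* Ranks start at 1. *)
Definition rank (N : {fset V}) (A : {fset X}) (P : profile N A) (i : N)
    (a : A) : nat :=
  (1 + #|[set b : A | prefers (P i) b a]|)%N.

Definition num_voters (N : {fset V}) (A : {fset X}) (P : profile N A)
    (rho : linear_order A) : nat :=
  #|[set i : N | P i == rho]|.

(* The values outside the domain (empty electorate, no alternative or more
   than mbar alternatives) are irrelevant and unconstrained. *)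
Record social_choice_rule (mbar : nat) := SocialChoiceRule {
  choice_set :> forall (N : {fset V}) (A : {fset X}), profile N A -> {set A};
  choice_set_neq0 : forall (N : {fset V}) (A : {fset X}) (P : profile N A),
    N != fset0 -> A != fset0 -> (#|` A| <= mbar)%N -> choice_set P != set0
}.

Definition add_incl (A : {fset X}) (x' : X) : A -> (x' |` A)%fset :=
  fincl (fsubsetU1 x' A).

Definition added (A : {fset X}) (x' : X) : (x' |` A)%fset :=
  [` fset1U1 x' A]%fset.

Definition clone_extension (p : rat) (N : {fset V}) (A : {fset X})
    (P : profile N A) (x : A) (x' : X) (Q : profile N (x' |` A)%fset) : Prop :=
  [/\ x' \notin A,
      restrict_profile (fsubsetU1 x' A) Q = P,
      forall i : N,
        `|(rank Q i (add_incl x' x))%:Z - (rank Q i (added A x'))%:Z| = 1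
    & forall rho : linear_order A,
        #|[set i : N | (P i == rho)
             && prefers (Q i) (add_incl x' x) (added A x')]|%:R
        = p * (num_voters P rho)%:R].

(* The preimage under the inclusion of A into x' |` A is F(Q) :&: A, seen as a
   set over A. *)
Definition clone_resistant (p : rat) (mbar : nat)
    (F : social_choice_rule mbar) : Prop :=
  forall (N : {fset V}) (A : {fset X}), N != fset0 -> A != fset0 ->
  (#|` A| + 1 <= mbar)%N ->
  forall (P : profile N A) (x : A) (x' : X) (Q : profile N (x' |` A)%fset),
  clone_extension p P x Q ->
  (@add_incl A x') @^-1: F N (x' |` A)%fset Q = F N A P.

End Profiles.

Section Positional.
Variables (R : realType) (V X : choiceType).

(* s m lists the scores s^m_1, ..., s^m_m; entry k of the vector is at
   position k - 1 of the tuple. Only the vectors with 1 <= m <= mbar matter for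
   a rule defined for at most mbar alternatives. *)
Definition total_score (s : forall m : nat, m.-tuple R) (N : {fset V})
    (A : {fset X}) (P : profile N A) (a : A) : R :=
  \sum_(i : N) (s #|` A|)`_(rank P i a).-1.

Definition positional_winners (s : forall m : nat, m.-tuple R) (N : {fset V})
    (A : {fset X}) (P : profile N A) : {set A} :=
  [set a | [forall b, total_score s P b <= total_score s P a]].

Lemma positional_winners_neq0 (mbar : nat) (s : forall m : nat, m.-tuple R)
    (N : {fset V}) (A : {fset X}) (P : profile N A) :
  N != fset0 -> A != fset0 -> (#|` A| <= mbar)%N ->
  positional_winners s P != set0.
Proof.
move=> _ /fset0Pn [x xA] _; pose x0 : A := [` xA]%fset.
have [a _ maxa] := @arg_maxP _ _ _ x0 xpredT (total_score s P) isT.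
by apply/set0Pn; exists a; rewrite inE; apply/forallP => b; apply: maxa.
Qed.

Definition positional_rule (mbar : nat) (s : forall m : nat, m.-tuple R) :
    social_choice_rule V X mbar :=
  SocialChoiceRule (@positional_winners_neq0 mbar s).

End Positional.

Section ScoreVectors.
Variable R : realType.

Definition equiv_scores (m : nat) (u v : m.-tuple R) : Prop :=
  exists lam c : R, 0 < lam /\
    forall i : 'I_m, tnth u i = lam * tnth v i + c.

Definition uses (s : forall m : nat, m.-tuple R) (m : nat) (v : m.-tuple R) :
    Prop :=
  equiv_scores (s m) v.

Definition is_trivial (mbar : nat) (s : forall m : nat, m.-tuple R) : Prop :=
  forall m, (1 <= m <= mbar)%N -> exists c : R, uses s [tuple c | _ < m].

Definition is_plurality (mbar : nat) (s : forall m : nat, m.-tuple R) : Prop :=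
  forall m, (2 <= m <= mbar)%N -> uses s [tuple (i == 0%N :> nat)%:R | i < m].

Definition is_inverse_plurality (mbar : nat)
    (s : forall m : nat, m.-tuple R) : Prop :=
  forall m, (2 <= m <= mbar)%N ->
    uses s [tuple (i == m.-1 :> nat)%:R | i < m].

End ScoreVectors.

(* Main.v *)
(** A p-clone extension acts on total scores by averaging: an alternative ranked
    j-th by a voter who ranks x k-th contributes [split_score p s^{m+1} k j] on
    average, and x' contributes [clone_score p s^{m+1} k]. If
    [split_score p s^{m+1} k j] is an increasing affine function of [s^m_j] with
    offset depending only on k, and x' never outscores x, the rule is resistant.
    Conversely, every finite list of orders, each held by as many voters as the
    denominator of p, has an extension, so ties and strict comparisons between
    winners must be transferred from [s^m] to [s^{m+1}]. The two-voter tie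
    {xy, yx} forces s^3_2 = (1 - p) s^3_1 + p s^3_3 unless s^2 is constant, and
    constant vectors stay constant. For 3 to 4 alternatives the cyclic profile
    forces s^4 = (w, v, v, w') with v = (1 - p) w + p w', and cloning x in
    {xyz, yxz} or {zxy, zyx}, where x and y tie, contradicts p in (0, 1). For
    p = 1 and p = 0 a two-voter tie between two alternatives propagates
    (inverse) plurality from s^m to s^{m+1}. *)
Require Import Defs.
From HB Require Import structures.
From mathcomp Require Import all_boot all_order all_algebra finmap.
From mathcomp Require Import boolp classical_sets cardinality reals.
From mathcomp Require Import fingroup perm ring lra zify.

Set Implicit Arguments.
Unset Strict Implicit.
Unset Printing Implicit Defensive.

Import Order.TTheory GRing.Theory Num.Theory.
Local Open Scope ring_scope.

(** * Positions in a linear order *)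

(** The rank minus one. [rank] is its successor by conversion, so score vectors are indexed by [pos]
    directly. *)
Definition pos (T : finType) (r : linear_order T) (a : T) : nat :=
  #|[set b | prefers r b a]|.

Section Positions.
Variables (T : finType) (r : linear_order T).

(** By transitivity, everything above the better alternative is above the worse one, which also has
    the better one above it. Totality then gives the converse. *)
Lemma prefers_pos a b : prefers r a b = (pos r a < pos r b)%N.
Proof.
have [irr tr tot] := prefers_strict_linear r.
have lt_pos c d : prefers r c d -> (pos r c < pos r d)%N.
  move=> cd; apply: proper_card; apply/properP; split.
    by apply/fintype.subsetP => e; rewrite !inE => /tr; apply.
  by exists c; rewrite !inE ?irr.
apply/idP/idP; first exact: lt_pos.
have [->|/eqP ab] := eqVneq a b; first by rewrite ltnn.
have /orP[//|/lt_pos ba] := tot _ _ ab.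
by move=> /(ltn_trans ba); rewrite ltnn.
Qed.

Lemma pos_inj : injective (pos r).
Proof.
move=> a b eq_ab; have [_ _ tot] := prefers_strict_linear r.
apply/eqP/negPn/negP => /eqP /tot.
by rewrite !prefers_pos eq_ab ltnn.
Qed.

Lemma pos_lt_card a : (pos r a < #|T|)%N.
Proof.
have [irr _ _] := prefers_strict_linear r.
rewrite -cardsT; apply: proper_card; apply/properP; split.
  exact: finset.subsetT.
by exists a; rewrite !inE ?irr.
Qed.

Lemma pos_succ a b : prefers r a b ->
  (forall c, ~~ (prefers r a c && prefers r c b)) -> pos r b = (pos r a).+1.
Proof.
have [irr tr tot] := prefers_strict_linear r => ab nbetween.
rewrite /pos (_ : [set c | prefers r c b] = a |: [set c | prefers r c a]).
  by rewrite cardsU1 inE irr.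
apply/setP => c; rewrite !inE; apply/idP/orP.
  move=> cb; have [->|/eqP /tot] := eqVneq c a; first by left.
  by case/orP; [right | move: (nbetween c); rewrite cb andbT => /negP].
by case=> [/eqP-> //|]; move=> /tr; apply.
Qed.

End Positions.

(** * Orders given by injective numberings *)

Section OrderOf.
Variables (T : finType) (f : T -> nat) (f_inj : injective f).

Lemma order_ofP :
  `[< strict_linear
        (fun a b => [ffun ab : T * T => (f ab.1 < f ab.2)%N] (a, b)) >].
Proof.
apply/asboolP; split=> [a|b a c|a b ab]; rewrite !ffunE /= ?ltnn //.
  exact: ltn_trans.
by rewrite -neq_ltn; apply/eqP => /f_inj.
Qed.

Definition order_of : linear_order T := LinearOrder order_ofP.

Lemma prefers_order_of a b : prefers order_of a b = (f a < f b)%N.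
Proof. by rewrite /prefers ffunE. Qed.

End OrderOf.

Lemma linear_order_eq (T : finType) (r1 r2 : linear_order T) :
  prefers r1 =2 prefers r2 -> r1 = r2.
Proof. by move=> eq12; apply: val_inj; apply/ffunP => -[a b]; apply: eq12. Qed.

Lemma card_set_bij (I J : finType) (e : I -> J) (B : pred J) :
  bijective e -> #|[set i | B (e i)]| = #|[set j | B j]|.
Proof.
move=> e_bij; have [g eK gK] := e_bij.
rewrite -(card_imset _ (bij_inj e_bij)); apply: eq_card => j.
rewrite [RHS]inE; apply/imsetP/idP => [[i + ->]|Bj]; first by rewrite inE.
by exists (g j); rewrite ?inE gK.
Qed.

Lemma card_ord_lt (n k : nat) : (k <= n)%N -> #|[set i : 'I_n | (i < k)%N]| = k.
Proof.
move=> le_kn; have widen_inj : injective (widen_ord le_kn).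
  by move=> i j /(congr1 val) /= /val_inj.
rewrite -[RHS]card_ord -(card_imset _ widen_inj).
apply: eq_card => i; rewrite inE; apply/idP/imsetP => [lt_ik|[j _ ->]] //=.
by exists (Ordinal lt_ik) => //; apply: val_inj.
Qed.

Lemma pos_order_of (T : finType) (n : nat) (f : T -> 'I_n)
    (f_inj : injective (fun a => f a : nat)) (f_bij : bijective f) a :
  pos (order_of f_inj) a = f a.
Proof.
rewrite /pos -[RHS](@card_ord_lt n) 1?ltnW //.
rewrite -(card_set_bij (fun i : 'I_n => (i < f a)%N) f_bij).
by apply: eq_card => b; rewrite !inE prefers_order_of.
Qed.

(** * Positions in a clone extension *)

Section Extension.
Variables (X : choiceType) (A : {fset X}) (x' : X).
Hypothesis x'A : x' \notin A.

Lemma add_incl_inj : injective (@add_incl X A x').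
Proof. by move=> a b /(congr1 val) /= /val_inj. Qed.

Lemma add_incl_neq (a : A) : add_incl x' a != added A x'.
Proof.
by apply/eqP => /(congr1 val) /= ax'; move: x'A; rewrite -ax' (valP a).
Qed.

Lemma added_cases (b : (x' |` A)%fset) :
  b = added A x' \/ exists a : A, b = add_incl x' a.
Proof.
have := fsvalP b; rewrite in_fset1U => /orP[/eqP bx'|bA].
  by left; apply: val_inj.
by right; exists [` bA]%fset; apply: val_inj.
Qed.

Lemma card_added (B : pred (x' |` A)%fset) :
  #|[set b | B b]| = (#|[set a : A | B (add_incl x' a)]| + B (added A x'))%N.
Proof.
rewrite -(card_imset _ add_incl_inj) (cardsD1 (added A x')) inE addnC.
congr (_ + _)%N; apply: eq_card => b; rewrite !inE.
apply/andP/imsetP => [[bn Bb]|[a]]; last first.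
  by rewrite inE => Ba ->; rewrite add_incl_neq.
have [b_new|[a ba]] := added_cases b; first by rewrite b_new eqxx in bn.
by exists a; rewrite ?inE -?ba.
Qed.

Variables (r : linear_order A) (t : linear_order (x' |` A)%fset) (x : A).
Hypothesis t_r : restrict_order (fsubsetU1 x' A) t = r.

Lemma prefers_add_incl a b :
  prefers t (add_incl x' a) (add_incl x' b) = prefers r a b.
Proof. by rewrite -t_r /prefers /= ffunE. Qed.

Lemma pos_add_incl a : pos t (add_incl x' a)
  = (pos r a + prefers t (added A x') (add_incl x' a))%N.
Proof.
rewrite /pos card_added; congr (_ + _)%N.
by apply: eq_card => b; rewrite !inE prefers_add_incl.
Qed.

Hypothesis adj :
  `|(pos t (add_incl x' x)).+1%:Z - (pos t (added A x')).+1%:Z| = 1.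

(** This position and that of [x'] are written through the same boolean, x above [x'], because
    condition (3) prescribes the frequency of exactly that event. *)
Lemma pos_clone_target : pos t (add_incl x' x)
  = (pos r x + ~~ prefers t (add_incl x' x) (added A x'))%N.
Proof.
rewrite pos_add_incl !prefers_pos; congr (_ + _)%N.
move: adj; set i := pos t _; set j := pos t _ => ij.
by rewrite -leqNgt; congr nat_of_bool; apply/idP/idP; lia.
Qed.

Lemma pos_clone_added : pos t (added A x')
  = (pos r x + prefers t (add_incl x' x) (added A x'))%N.
Proof.
have := pos_clone_target; rewrite !prefers_pos.
move: adj; set i := pos t _; set j := pos t _ => ij.
by case: ltnP => /=; lia.
Qed.

(** Nothing fits between x and [x'], so another alternative moves down by one exactly when x was
    above it, which is what [bump] expresses. *)
Lemma pos_clone_other a : a != x ->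
  pos t (add_incl x' a) = bump (pos r x) (pos r a).
Proof.
move=> ax; rewrite pos_add_incl /bump addnC; congr (_ + _)%N.
rewrite prefers_pos.
have := prefers_add_incl x a; rewrite !prefers_pos.
have : pos t (add_incl x' a) <> pos t (add_incl x' x).
  by move=> /pos_inj/add_incl_inj/eqP; rewrite (negbTE ax).
have : pos t (add_incl x' a) <> pos t (added A x').
  by move=> /pos_inj/eqP; rewrite (negbTE (add_incl_neq a)).
have : pos r x <> pos r a by move=> /pos_inj/eqP; rewrite eq_sym (negbTE ax).
move: adj; lia.
Qed.

End Extension.

(** * Scores averaged over voters with the same order *)

(* Here [k] is the position of x, and positions are counted from 0, unlike the
   ranks in the header. *)
Definition split_score (R : realType) (q : R) (v : seq R) (k j : nat) : R :=
  if j == k then q * v`_k + (1 - q) * v`_k.+1 else v`_(bump k j).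

Definition clone_score (R : realType) (q : R) (v : seq R) (k : nat) : R :=
  (1 - q) * v`_k + q * v`_k.+1.

(** Inside a class of [P] only the truth value of [B] varies and the summand is affine in it, so the
    class total depends only on how often [B] holds, a share q of the class. *)
Lemma sum_class_average (R : realType) (I O : finType) (P : I -> O)
    (B : pred I) (q : R) (f : O -> bool -> R) :
  (forall o, #|[set i | (P i == o) && B i]|%:R
             = q * #|[set i | P i == o]|%:R) ->
  \sum_i f (P i) (B i)
  = \sum_i (q * f (P i) true + (1 - q) * f (P i) false).
Proof.
move=> freqB.
rewrite (partition_big P xpredT) // [RHS](partition_big P xpredT) //=.
apply: eq_bigr => o _.
transitivity (\sum_(i | P i == o) f o false
              + (\sum_(i | P i == o) (B i)%:R) * (f o true - f o false)).
  rewrite mulr_suml -big_split; apply: eq_bigr => i /eqP ->.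
  by case: (B i) => /=; ring.
rewrite (_ : \sum_(i | P i == o) (B i)%:R
             = q * \sum_(i | P i == o) 1 :> R); last first.
  have := freqB o; rewrite -!sum1dep_card !natr_sum => <-.
  by rewrite big_mkcondr; apply: eq_bigr => i _; case: (B i).
rewrite mulrAC mulr_sumr -big_split /=.
by apply: eq_bigr => i /eqP ->; ring.
Qed.

Lemma total_scoreE (R : realType) (V X : choiceType)
    (s : forall m : nat, m.-tuple R) (N : {fset V}) (A : {fset X})
    (P : profile N A) a :
  total_score s P a = \sum_i (s #|` A|)`_(pos (P i) a).
Proof. by []. Qed.

Section TotalScores.
Variables (R : realType) (V X : choiceType) (p : rat).
Variables (s : forall m : nat, m.-tuple R).
Variables (N : {fset V}) (A : {fset X}) (P : profile N A) (x : A) (x' : X)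
  (Q : profile N (x' |` A)%fset).
Hypothesis PQ : clone_extension p P x Q.

Let above i := prefers (Q i) (add_incl x' x) (added A x').

Let restrictQ i : restrict_order (fsubsetU1 x' A) (Q i) = P i.
Proof. by case: PQ => _ <- _ _; rewrite ffunE. Qed.

Let freq_above o :
  #|[set i | (P i == o) && above i]|%:R
  = ratr p * #|[set i | P i == o]|%:R :> R.
Proof.
by have [_ _ _ /(_ o) /(congr1 (@ratr R))] := PQ; rewrite rmorphM /= !ratr_nat.
Qed.

(** A share p of the voters with a given order keeps x at its position k and the others move it to k
    + 1; the new position of any other alternative is determined by the order alone. *)
Lemma total_score_add_incl a : total_score s Q (add_incl x' a)
  = \sum_i split_score (ratr p) (s #|` A|.+1) (pos (P i) x) (pos (P i) a).
Proof.
have [x'A _ adj _] := PQ.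
rewrite total_scoreE cardfsU1 x'A add1n.
have [->|ax] := eqVneq a x.
  transitivity (\sum_i (s #|` A|.+1)`_(pos (P i) x + ~~ above i)).
    apply: eq_bigr => i _.
    by rewrite (pos_clone_target x'A (restrictQ i) (adj i)).
  rewrite (sum_class_average
             (fun r b => (s #|` A|.+1)`_(pos r x + ~~ b)) freq_above) /=.
  by apply: eq_bigr => i _; rewrite /split_score eqxx addn0 addn1.
apply: eq_bigr => i _; rewrite /split_score.
rewrite (pos_clone_other x'A (restrictQ i) (adj i) ax).
by case: eqP => // /pos_inj/eqP; rewrite (negbTE ax).
Qed.

Lemma total_score_added : total_score s Q (added A x')
  = \sum_i clone_score (ratr p) (s #|` A|.+1) (pos (P i) x).
Proof.
have [x'A _ adj _] := PQ.
rewrite total_scoreE cardfsU1 x'A add1n.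
under eq_bigr => i _ do rewrite (pos_clone_added x'A (restrictQ i) (adj i)).
rewrite (sum_class_average
           (fun r b => (s #|` A|.+1)`_(pos r x + b)) freq_above) /=.
by apply: eq_bigr => i _; rewrite addn0 addn1 addrC.
Qed.

Lemma mem_positional_winners_ext a :
  (add_incl x' a \in positional_winners s Q)
  = [forall b, total_score s Q (add_incl x' b)
               <= total_score s Q (add_incl x' a)]
    && (total_score s Q (added A x') <= total_score s Q (add_incl x' a)).
Proof.
rewrite inE; apply/forallP/andP => [win | [/forallP win win'] b].
  by split; [apply/forallP => b|]; apply: win.
by have [->|[c ->]] := added_cases b.
Qed.

End TotalScores.

(** * A sufficient condition for resistance *)

(** The offsets depend only on the position of x, so summed over the voters they shift all old
    alternatives equally and old comparisons survive. The clone never outscores x, hence never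
    displaces a winner. *)
Lemma clone_resistant_affine (R : realType) (V X : choiceType) (p : rat)
    (mbar : nat) (s : forall m : nat, m.-tuple R) :
  (forall m, (0 < m < mbar)%N -> exists (lam : R) (c : nat -> R),
     [/\ 0 < lam,
         forall k j, (k < m)%N -> (j < m)%N ->
           split_score (ratr p) (s m.+1) k j = lam * (s m)`_j + c k
       & forall k, (k < m)%N ->
           clone_score (ratr p) (s m.+1) k
           <= split_score (ratr p) (s m.+1) k k]) ->
  clone_resistant p (positional_rule V X mbar s).
Proof.
move=> affine N A N0 A0 Am P x x' Q PQ.
have [|lam [c [lam0 splitE clone_le]]] := affine #|` A|.
  by rewrite cardfs_gt0 A0 -addn1.
have pos_lt i a : (pos (P i) a < #|` A|)%N.
  by rewrite cardfE pos_lt_card.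
have scoreE a : total_score s Q (add_incl x' a)
    = lam * total_score s P a + \sum_i c (pos (P i) x).
  rewrite (total_score_add_incl s PQ) mulr_sumr -big_split /=.
  by apply: eq_bigr => i _; rewrite splitE.
have clone_le_target :
    total_score s Q (added A x') <= total_score s Q (add_incl x' x).
  rewrite (total_score_added s PQ) (total_score_add_incl s PQ).
  by apply: ler_sum => i _; apply: clone_le.
apply/setP => a; rewrite inE /= mem_positional_winners_ext inE.
apply/andP/forallP => [[/forallP win _] b | win].
  by have := win b; rewrite !scoreE lerD2r ler_pM2l.
have winQ b : total_score s Q (add_incl x' b)
             <= total_score s Q (add_incl x' a).
  by rewrite !scoreE lerD2r ler_pM2l.
by split; [apply/forallP|apply: le_trans (winQ x)].
Qed.

(** * Existence of clone extensions *)

Lemma exists_clone_order (X : choiceType) (A : {fset X}) (x' : X)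
    (r : linear_order A) (x : A) (above : bool) : x' \notin A ->
  exists t : linear_order (x' |` A)%fset,
    [/\ restrict_order (fsubsetU1 x' A) t = r,
        `|(pos t (add_incl x' x)).+1%:Z - (pos t (added A x')).+1%:Z| = 1
      & prefers t (add_incl x' x) (added A x') = above].
Proof.
move=> x'A.
(* Spacing by three leaves 3k and 3k + 2 free around the value 3k + 1 of the alternative at position
   k, so [x'] fits next to x on either side; smaller values rank higher. *)
pose f (b : (x' |` A)%fset) : nat :=
  if insub (val b) is Some a then (3 * pos r a).+1
  else (3 * pos r x + (if above then 2 else 0))%N.
have f_incl a : f (add_incl x' a) = (3 * pos r a).+1.
  by rewrite /f (_ : insub _ = Some a) //= valK.
have f_added : f (added A x') = (3 * pos r x + (if above then 2 else 0))%N.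
  by rewrite /f insubN.
have f_inj : injective f.
  move=> b c; have [->|[a ->]] := added_cases b;
    have [->|[a' ->]] := added_cases c.
  - by [].
  - by rewrite f_incl f_added; case: above {f f_incl f_added} => /=; lia.
  - by rewrite f_incl f_added; case: above {f f_incl f_added} => /=; lia.
  - rewrite !f_incl => aa'; congr add_incl; apply: (@pos_inj _ r); lia.
have tP := prefers_order_of f_inj.
exists (order_of f_inj); split.
- apply: linear_order_eq => a b.
  rewrite [LHS]/prefers /= ffunE /= tP !f_incl prefers_pos; lia.
- have between c : ~~ (prefers (order_of f_inj) (add_incl x' x) c
        && prefers (order_of f_inj) c (added A x'))
      /\ ~~ (prefers (order_of f_inj) (added A x') c
        && prefers (order_of f_inj) c (add_incl x' x)).
    rewrite !tP f_incl f_added; have [->|[a ->]] := added_cases c.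
      by rewrite f_added; case: above {f f_incl f_added f_inj tP}; split; lia.
    by rewrite f_incl; case: above {f f_incl f_added f_inj tP}; split; lia.
  case: above @f f_incl f_added f_inj tP between
    => f f_incl f_added f_inj tP between.
    rewrite (@pos_succ _ (order_of f_inj) (add_incl x' x) (added A x')).
    + by move: (pos _ _) => k; lia.
    + by rewrite tP f_incl f_added; lia.
    + by move=> c; have [] := between c.
  rewrite (@pos_succ _ (order_of f_inj) (added A x') (add_incl x' x)).
  + by move: (pos _ _) => k; lia.
  + by rewrite tP f_incl f_added; lia.
  + by move=> c; have [] := between c.
- by rewrite tP f_incl f_added; case: above {f f_incl f_added f_inj tP}; lia.
Qed.

Lemma infinite_fset_bij (T : choiceType) (I : finType) :
  infinite_set [set: T]%classic ->
  exists (A : {fset T}) (e : A -> I), bijective e.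
Proof.
move=> /(infinite_set_fset #|I|) [B _ ge_B].
pose A := [fset x in take #|I| (enum_fset B)]%fset.
have cardA : #|{: A}| = #|I|.
  by rewrite -cardfE card_fseq undup_id ?take_uniq ?fset_uniq // size_takel.
exists A, (fun a => enum_val (cast_ord cardA (enum_rank a))).
exists (fun i => enum_val (cast_ord (esym cardA) (enum_rank i))) => a.
  by rewrite enum_valK cast_ordK enum_rankK.
by rewrite enum_valK cast_ordKV enum_rankK.
Qed.

(** Each order in the list is given to [denq p] voters, [numq p] of whom place x above [x'], so
    condition (3) holds with integer counts. The sum formula has an arbitrary [f] so that it covers
    the scores before cloning, those after it, and the score of the clone. *)
Lemma exists_clone_extension (V X : choiceType) (p : rat) (m : nat)
    (r : seq 'S_m) (x : 'I_m) :
  infinite_set [set: V]%classic -> infinite_set [set: X]%classic ->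
  0 <= p <= 1 -> r != [::] ->
  exists (N : {fset V}) (A : {fset X}) (P : profile N A) (x0 : A) (x' : X)
      (Q : profile N (x' |` A)%fset) (e : A -> 'I_m) (c : nat),
    [/\ N != fset0, bijective e, e x0 = x, clone_extension p P x0 Q & (0 < c)%N
      /\ forall (R : nmodType) (f : nat -> nat -> R) a,
        \sum_i f (pos (P i) x0) (pos (P i) a)
        = (\sum_(g <- r) f (g x) (g (e a))) *+ c].
Proof.
move=> infV infX /andP[p0 p1] r0.
pose q := `|denq p|%N; pose n := `|numq p|%N.
have q0 : (0 < q)%N by rewrite absz_gt0 denq_neq0.
have pE : p * q%:R = n%:R.
  have qZ : q%:R = (denq p)%:~R :> rat by rewrite -[denq p]absz_denq.
  have nZ : n%:R = (numq p)%:~R :> rat.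
    by rewrite -[in RHS](@gez0_abs (numq p)) ?numq_ge0.
  by rewrite qZ nZ -{1}(divq_num_den p) divfK // intr_eq0 denq_neq0.
have le_nq : (n <= q)%N.
  by rewrite -(ler_nat rat) -pE ler_piMl.
have [A [e e_bij]] := @infinite_fset_bij X 'I_m infX.
have [N [d d_bij]] := @infinite_fset_bij V ('I_(size r) * 'I_q)%type infV.
have [e' eK e'K] := e_bij; have [d' dK d'K] := d_bij.
have [x' _ x'A] : exists2 x', True & x' \notin A.
  have /infinite_setN0 [x' [_ /= x'A]] :
      infinite_set ([set: X] `\` [set` A])%classic by apply: infinite_setD.
  by exists x' => //; apply/negP.
pose ord_of (g : 'S_m) : linear_order A :=
  order_of (inj_comp (@ord_inj m) (inj_comp (@perm_inj _ g) (bij_inj e_bij))).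
have pos_ord_of g a : pos (ord_of g) a = g (e a).
  rewrite (pos_order_of (f := g \o e)) //.
  by apply: bij_comp => //; exists (g^-1)%g => y; rewrite ?permK ?permKV.
(* The default [1%g] is never read, since [(d i).1] is below [size r]. *)
pose P : profile N A := [ffun i => ord_of (nth 1%g r (d i).1)].
have /choice [t tP] i :=
  exists_clone_order (P i) (e' x) ((d i).2 < n)%N x'A.
pose Q : profile N (x' |` A)%fset := [ffun i => t i].
exists N, A, P, (e' x), x', Q, e, q; split=> //.
- apply/fset0Pn.
  have lt0r : (0 < size r)%N by rewrite lt0n size_eq0.
  by exists (val (d' (Ordinal lt0r, Ordinal q0))); apply: valP.
- split=> //.
  + by apply/ffunP => i; rewrite !ffunE; have [] := tP i; rewrite ffunE.
  + by move=> i; rewrite /rank !ffunE; have [] := tP i.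
  + move=> rho.
    (* The list may repeat an order, so the voters holding [rho] come from all its occurrences, [q]
       voters for each. *)
    pose B := [set l : 'I_(size r) | ord_of (nth 1%g r l) == rho].
    have cardB (C : pred 'I_q) :
        #|[set i : N | (P i == rho) && C (d i).2]|
        = (#|B| * #|[set j | C j]|)%N.
      rewrite -cardsX -[RHS]cardsE.
      rewrite -(card_set_bij _ d_bij); apply: eq_card => i.
      by rewrite !inE ffunE.
    rewrite (eq_card (B := [set i : N | (P i == rho) && ((d i).2 < n)%N])).
      rewrite (cardB (fun j : 'I_q => (j < n)%N)) card_ord_lt // natrM -pE.
      rewrite /num_voters (eq_card (B := [set i | (P i == rho) && true])).
        by rewrite (cardB xpredT) cardsT card_ord natrM; ring.
      by move=> i; rewrite !inE andbT.
    by move=> i; rewrite !inE [Q i]ffunE; have [_ _ ->] := tP i.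
- split=> // R f a.
  rewrite (reindex d'); last by exists d => i _.
  under eq_bigr => i _ do rewrite ffunE !pos_ord_of e'K d'K.
  rewrite -(pair_bigA _ (fun (l : 'I_(size r)) (_ : 'I_q) =>
     f (nth 1%g r l x) (nth 1%g r l (e a)))) /=.
  rewrite (big_nth 1%g) big_mkord -sumrMnl; apply: eq_bigr => l _.
  by rewrite sumr_const card_ord.
Qed.

(** * Necessary conditions on the score vectors *)

Section Necessity.
Variables (R : realType) (V X : choiceType).
Hypotheses (infV : infinite_set [set: V]%classic)
  (infX : infinite_set [set: X]%classic).
Variables (p : rat) (mbar : nat) (s : forall m : nat, m.-tuple R).
Hypothesis p01 : 0 <= p <= 1.
Hypothesis resF : clone_resistant p (positional_rule V X mbar s).
Let q : R := ratr p.

Local Notation score m r a := (\sum_(g <- r) (s m)`_(g a)).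
Local Notation split_total m r x a :=
  (\sum_(g <- r) split_score q (s m.+1) (g x) (g a)).
Local Notation clone_total m r x :=
  (\sum_(g <- r) clone_score q (s m.+1) (g x)).

(* Alternatives are the elements of ['I_m], and a permutation stands for the
   order in which it sends each alternative to its position. *)
Lemma resistant_winners m (r : seq 'S_m) (x a : 'I_m) :
  (m < mbar)%N -> r != [::] ->
  (forall b, score m r b <= score m r a) <->
  (forall b, split_total m r x b
             <= split_total m r x a) /\
  clone_total m r x
    <= split_total m r x a.
Proof.
move=> lt_m r0.
have [N [A [P [x0 [x' [Q [e [c [N0 e_bij ex PQ [c0 sumE]]]]]]]]]] :=
  exists_clone_extension x infV infX p01 r0.
have cardA : #|` A| = m by rewrite cardfE (bij_eq_card e_bij) card_ord.
have A0 : A != fset0.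
  by rewrite -cardfs_gt0 cardA (leq_ltn_trans _ (ltn_ord x)).
have [e' eK e'K] := e_bij.
have leA : (#|` A| + 1 <= mbar)%N by rewrite cardA addn1.
have /setP/(_ (e' a)) := resF N0 A0 leA PQ.
rewrite inE /= mem_positional_winners_ext inE.
(* Every total is [c] times a sum over the list, and the positive [c] cancels from all
   comparisons. *)
have scoreP b : total_score s P b = score m r (e b) *+ c.
  by rewrite total_scoreE cardA (sumE _ (fun _ k => (s m)`_k)).
have scoreQ b : total_score s Q (add_incl x' b)
    = split_total m r x (e b) *+ c.
  by rewrite (total_score_add_incl s PQ) cardA (sumE _ (split_score q _)).
have scoreC : total_score s Q (added A x')
    = (clone_total m r x) *+ c.
  rewrite (total_score_added s PQ) cardA.
  by rewrite (sumE _ (fun k _ => clone_score q _ k)).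

rewrite scoreC scoreQ e'K lerMn2r -[c == 0]negbK -lt0n c0 /= => winE.
split=> [win|[win win']].
  have /andP[/forallP winQ ->] : [forall b, total_score s Q (add_incl x' b)
      <= (split_total m r x a) *+ c] &&
      (clone_total m r x
       <= split_total m r x a).
    rewrite winE; apply/forallP => b.
    by rewrite !scoreP e'K lerMn2r win orbT.
  split=> // b; have := winQ (e' b).
  by rewrite scoreQ e'K lerMn2r -[c == 0]negbK -lt0n c0.
move: winE; rewrite win' andbT => winE.
have /forallP winP : [forall b, total_score s P b <= total_score s P (e' a)].
  by rewrite -winE; apply/forallP => b; rewrite scoreQ lerMn2r win orbT.
move=> b; have := winP (e' b).
by rewrite !scoreP !e'K lerMn2r -[c == 0]negbK -lt0n c0.
Qed.

(** Two winners at the original profile both win at the extension, so neither outscores the other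
    there. *)
Lemma resistant_tie m (r : seq 'S_m) (x a b : 'I_m) :
  (m < mbar)%N -> r != [::] ->
  (forall c, score m r c <= score m r a) ->
  score m r b = score m r a ->
  split_total m r x b
  = split_total m r x a.
Proof.
move=> lt_m r0 win_a eq_ab; apply/le_anti.
have [/(_ win_a) [-> _] _] := resistant_winners x a lt_m r0.
rewrite /=; have [+ _] := resistant_winners x b lt_m r0.
by rewrite eq_ab => /(_ win_a) [-> _].
Qed.

(** If [b] scored at least as much as [a] after cloning, it would match or beat all alternatives and
    the clone as [a] does, so it would win there and hence already before. *)
Lemma resistant_lt m (r : seq 'S_m) (x a b : 'I_m) :
  (m < mbar)%N -> r != [::] ->
  (forall c, score m r c <= score m r a) ->
  score m r b < score m r a ->
  split_total m r x b
  < split_total m r x a.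
Proof.
move=> lt_m r0 win_a; rewrite !ltNge; apply: contra => le_ab.
have [/(_ win_a) [winQ winC] _] := resistant_winners x a lt_m r0.
have [_ +] := resistant_winners x b lt_m r0; apply.
by split=> [c|]; apply: le_trans le_ab.
Qed.

(** A lone alternative wins, so its clone must not outscore it. Equivalently, 2q - 1 and the
    difference of the two scores never have opposite signs, which is where the comparison of p with
    1/2 originates. *)
Lemma resistant_pair : (1 < mbar)%N ->
  (1 - q) * (s 2)`_0 + q * (s 2)`_1 <= q * (s 2)`_0 + (1 - q) * (s 2)`_1.
Proof.
move=> lt_1.
have [+ _] := @resistant_winners 1 [:: 1%g] ord0 ord0 lt_1 isT.
case=> [b|_]; first by rewrite (ord1 b).
by rewrite !big_cons !big_nil /= !perm1 !addr0.
Qed.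

(** With a constant vector all alternatives tie for a single voter. Cloning the one at position k
    then makes every entry outside positions k and k + 1 equal to their mean with weights q and 1 -
    q. The first and the last k suffice. *)
Lemma resistant_const m : (1 < m < mbar)%N ->
  (forall j, (j < m)%N -> (s m)`_j = (s m)`_0) ->
  forall j, (j <= m)%N -> (s m.+1)`_j = (s m.+1)`_0.
Proof.
case: m => [|m] //= /andP[lt1m lt_m] const.
set v := (s m.+2 : seq R).
have splitE (k j : 'I_m.+1) : split_score q v k j = split_score q v k k.
  have := @resistant_tie _ [:: 1%g] k k j lt_m isT.
  rewrite !big_seq1 !perm1; apply=> [c|]; last by rewrite const // [RHS]const.
  by rewrite !big_seq1 !perm1 const // [leRHS]const.
have upE j : (0 < j <= m)%N -> v`_j.+1 = q * v`_0 + (1 - q) * v`_1.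
  case/andP=> j0 jm; have := splitE ord0 (Ordinal (jm : j < m.+1)%N).
  by rewrite /split_score /= gtn_eqF // /bump j0.
have downE j : (j < m)%N -> v`_j = q * v`_m + (1 - q) * v`_m.+1.
  move=> jm; have := splitE ord_max (Ordinal (ltnW jm : j < m.+1)%N).
  by rewrite /split_score /= eqxx ltn_eqF // /bump leqNgt jm.
case: m lt1m lt_m @v const splitE upE downE => [//|[|m]] _ _ v _ _ upE downE.
  have v2 := upE 1%N isT; have v0 := downE 0%N isT.
  (* Eliminating the last of the three entries leaves the factor 1 - q + q^2, written as a completed
     square to show that it is positive. *)
  have : (v`_0 - v`_1) * ((q - 1 / 2) ^+ 2 + 3 / 4) = 0.
    by rewrite v2 in v0; lra.
  have c0 : 0 < (q - 1 / 2) ^+ 2 + 3 / 4 by have := sqr_ge0 (q - 1 / 2); lra.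
  move/eqP; rewrite mulf_eq0 (gt_eqF c0) orbF subr_eq0 => /eqP v01.
  by case=> [|[|[|//]]] //= _; rewrite v2 v01; ring.
have v10 : v`_1 = v`_0 by rewrite (downE 1%N) // (downE 0%N).
case=> [|[|j]] // jm; rewrite (upE j.+1) // v10; ring.
Qed.

(** After x is cloned in the profile of one order xy and one order yx, the tie reads v_0 + v_2 = q
    v_0 + v_1 + (1 - q) v_2, where v is [s 3]. *)
Lemma resistant_middle : (2 < mbar)%N -> (s 2)`_0 != (s 2)`_1 ->
  (s 3)`_1 = (1 - q) * (s 3)`_0 + q * (s 3)`_2.
Proof.
move=> lt2 neq_u; pose i : 'I_2 := ord0; pose j : 'I_2 := ord_max.
pose r := [:: 1%g; tperm i j].
have scoreE c : score 2 r c = (s 2)`_0 + (s 2)`_1.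
  by case: c => -[|[|//]] lt_c; rewrite !big_cons !big_nil !permE /=; ring.
have : split_total 2 r i j = split_total 2 r i i.
  by apply: resistant_tie => // [c|]; rewrite !scoreE.
rewrite !big_cons !big_nil !permE /= /split_score /= /bump /=; lra.
Qed.

(** A single voter carries a strict comparison from [s 2] to [s 3]: given the middle entry, the gap
    after cloning the top alternative is the positive number 1 - q + q^2 times the difference of the
    end entries. *)
Lemma resistant_ends : (2 < mbar)%N -> (s 2)`_0 != (s 2)`_1 ->
  ((s 3)`_2 < (s 3)`_0) = ((s 2)`_1 < (s 2)`_0) /\
  ((s 3)`_0 < (s 3)`_2) = ((s 2)`_0 < (s 2)`_1).
Proof.
move=> lt2 neq_u; have mid := resistant_middle lt2 neq_u.
pose i : 'I_2 := ord0; pose j : 'I_2 := ord_max; pose r : seq 'S_2 := [:: 1%g].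
have score0 : score 2 r i = (s 2)`_0 by rewrite big_seq1 perm1.
have score1 : score 2 r j = (s 2)`_1 by rewrite big_seq1 perm1.
have c0 : 0 < (q - 1 / 2) ^+ 2 + 3 / 4 by have := sqr_ge0 (q - 1 / 2); lra.
have splitE : split_total 2 r i i - split_total 2 r i j
    = ((q - 1 / 2) ^+ 2 + 3 / 4) * ((s 3)`_0 - (s 3)`_2).
  rewrite !big_seq1 !perm1 /split_score /= /bump /= mid add1n; by field.
have [lt01|lt10|/eqP eq01] := ltgtP (s 2)`_0 (s 2)`_1.
- have : split_total 2 r i i < split_total 2 r i j.
    apply: resistant_lt => // [c|]; rewrite ?score0 ?score1 //.
    by case: c => -[|[|//]] lt_c; rewrite big_seq1 perm1 //= ltW.
  rewrite -subr_lt0 splitE pmulr_rlt0 // subr_lt0 => lt_v.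
  by rewrite lt_v ltNge (ltW lt_v).
- have : split_total 2 r i j < split_total 2 r i i.
    apply: resistant_lt => // [c|]; rewrite ?score0 ?score1 //.
    by case: c => -[|[|//]] lt_c; rewrite big_seq1 perm1 //= ltW.
  rewrite -subr_gt0 splitE pmulr_rgt0 // subr_gt0 => lt_v.
  by rewrite lt_v ltNge (ltW lt_v).
- by rewrite eq01 in neq_u.
Qed.

(** The cycle fixes the shape of [s 4]. If the ends of [s 3] differed, a two-voter profile would
    have x and y tied strictly ahead of z; keeping the tie after cloning x makes [s 4] constant, so
    z could not stay strictly behind. *)
Lemma resistant_three : (3 < mbar)%N -> 0 < q < 1 ->
  (s 3)`_1 = (1 - q) * (s 3)`_0 + q * (s 3)`_2 -> (s 3)`_0 = (s 3)`_2.
Proof.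
move=> lt3 /andP[q0 q1] mid; apply/eqP/negPn/negP => neq_u.
pose x : 'I_3 := Ordinal (isT : (0 < 3)%N).
pose y : 'I_3 := Ordinal (isT : (1 < 3)%N).
pose z : 'I_3 := Ordinal (isT : (2 < 3)%N).
pose yzx : 'S_3 := (tperm x y * tperm y z)%g.
pose zxy : 'S_3 := (tperm y z * tperm x y)%g.
pose cyc : seq 'S_3 := [:: 1%g; yzx; zxy].
have cycE c : score 3 cyc c = (s 3)`_0 + (s 3)`_1 + (s 3)`_2.
  case: c => -[|[|[|//]]] lt_c;
  by rewrite !big_cons !big_nil !permE /= !permE /=; ring.
have cyc_tie a : split_total 3 cyc x a = split_total 3 cyc x x.
  by apply: resistant_tie => // [c|]; rewrite !cycE.
set v := (s 4 : seq R) in cyc_tie.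
have cyc_y : v`_2 + v`_0 + v`_3 = (q * v`_0 + (1 - q) * v`_1)
    + (q * v`_2 + (1 - q) * v`_3) + (q * v`_1 + (1 - q) * v`_2).
  have := cyc_tie y; rewrite !big_cons !big_nil !permE /= !permE /=.
  by rewrite /split_score /= /bump /=; lra.
have cyc_z : v`_3 + v`_1 + v`_0 = (q * v`_0 + (1 - q) * v`_1)
    + (q * v`_2 + (1 - q) * v`_3) + (q * v`_1 + (1 - q) * v`_2).
  have := cyc_tie z; rewrite !big_cons !big_nil !permE /= !permE /=.
  by rewrite /split_score /= /bump /=; lra.
have v21 : v`_2 = v`_1 by lra.
rewrite v21 in cyc_y.
have v1E : v`_1 = (1 - q) * v`_0 + q * v`_3 by lra.
have [lt_u|lt_u|/eqP eq_u] := ltgtP (s 3)`_0 (s 3)`_2; last first.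
- by rewrite eq_u in neq_u.
(* The orders xyz and yxz: the last score is the smallest, so z, always last, is strictly behind. *)
- pose r : seq 'S_3 := [:: 1%g; tperm x y].
  have le_mid : (s 3)`_2 < (s 3)`_1.
    by rewrite -subr_gt0 (_ : _ - _ = (1 - q) * ((s 3)`_0 - (s 3)`_2));
      [rewrite mulr_gt0 ?subr_gt0 | rewrite mid; ring].
  have scorex : score 3 r x = (s 3)`_0 + (s 3)`_1.
    by rewrite !big_cons !big_nil !permE /=; ring.
  have scorey : score 3 r y = (s 3)`_0 + (s 3)`_1.
    by rewrite !big_cons !big_nil !permE /=; ring.
  have scorez : score 3 r z = (s 3)`_2 + (s 3)`_2.
    by rewrite !big_cons !big_nil !permE /=; ring.
  have win c : score 3 r c <= score 3 r x.
    case: c => -[|[|[|//]]] lt_c; rewrite !(bool_irrelevance lt_c isT).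
    + by rewrite lexx.
    + by rewrite -/y scorey scorex.
    + by rewrite -/z scorez scorex; lra.
  have : split_total 3 r x y = split_total 3 r x x.
    by apply: resistant_tie => //; rewrite scorey.
  have : split_total 3 r x z < split_total 3 r x x.
    by apply: resistant_lt => //; rewrite scorez scorex; lra.
  rewrite !big_cons !big_nil !permE /= /split_score /= /bump /=.
  rewrite -/v v21 => lt_v eq_v.
  have /eqP : (1 - q) * (v`_1 - v`_0) = 0 by lra.
  rewrite mulf_eq0 gt_eqF ?subr_gt0 //= subr_eq0 => /eqP v10.
  have /eqP : q * (v`_3 - v`_0) = 0 by lra.
  rewrite mulf_eq0 gt_eqF //= subr_eq0 => /eqP v30.
  by rewrite v10 v30 in lt_v; lra.
(* The orders zxy and zyx: the first score is the smallest, so z, always first, is strictly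
   behind. *)
- pose r : seq 'S_3 := [:: zxy; tperm x z].
  have le_mid : (s 3)`_0 < (s 3)`_1.
    by rewrite -subr_gt0 (_ : _ - _ = q * ((s 3)`_2 - (s 3)`_0));
      [rewrite mulr_gt0 ?subr_gt0 | rewrite mid; ring].
  have scorex : score 3 r x = (s 3)`_1 + (s 3)`_2.
    by rewrite !big_cons !big_nil !permE /= !permE /=; ring.
  have scorey : score 3 r y = (s 3)`_1 + (s 3)`_2.
    by rewrite !big_cons !big_nil !permE /= !permE /=; ring.
  have scorez : score 3 r z = (s 3)`_0 + (s 3)`_0.
    by rewrite !big_cons !big_nil !permE /= !permE /=; ring.
  have win c : score 3 r c <= score 3 r x.
    case: c => -[|[|[|//]]] lt_c; rewrite !(bool_irrelevance lt_c isT).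
    + by rewrite lexx.
    + by rewrite -/y scorey scorex.
    + by rewrite -/z scorez scorex; lra.
  have : split_total 3 r x y = split_total 3 r x x.
    by apply: resistant_tie => //; rewrite scorey.
  have : split_total 3 r x z < split_total 3 r x x.
    by apply: resistant_lt => //; rewrite scorez scorex; lra.
  rewrite !big_cons !big_nil !permE /= !permE /= /split_score /= /bump /=.
  rewrite -/v v21 => lt_v eq_v.
  have /eqP : q * (v`_1 - v`_3) = 0 by lra.
  rewrite mulf_eq0 gt_eqF //= subr_eq0 => /eqP v13.
  have /eqP : (1 - q) * (v`_0 - v`_3) = 0 by lra.
  rewrite mulf_eq0 gt_eqF ?subr_gt0 //= subr_eq0 => /eqP v03.
  by rewrite v13 v03 in lt_v; lra.
Qed.

(** The position [t] with the exceptional score is the first for plurality and the last for inverse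
    plurality; [t] also names the cloned alternative, which the first voter puts there. The second
    voter's order [h] puts [j] at position [t] and [t] at position [k], so [t] and [j] tie as
    winners. *)
Lemma resistant_special m (t : 'I_m) (c : R) : (m < mbar)%N ->
  (forall j : 'I_m, j != t -> (s m)`_j = c) -> c < (s m)`_t ->
  forall j : 'I_m, j != t ->
  split_score q (s m.+1) t j < split_score q (s m.+1) t t /\
  forall k : 'I_m, k != t ->
    split_score q (s m.+1) t t + split_score q (s m.+1) k k
    = split_score q (s m.+1) t j + split_score q (s m.+1) k t.
Proof.
move=> lt_m const lt_c j jt.
have le_top (i : 'I_m) : (s m)`_i <= (s m)`_t.
  have [->//|it] := eqVneq i t.
  by rewrite (const i it) ltW.
split=> [|k kt].
  pose r : seq 'S_m := [:: 1%g].
  have : split_total m r t j < split_total m r t t.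
    by apply: resistant_lt => // [b|]; rewrite !big_seq1 !perm1 // (const j jt).
  by rewrite !big_seq1 !perm1.
pose h : 'S_m := (tperm t j * tperm j k)%g; pose r : seq 'S_m := [:: 1%g; h].
have ht : h t = k by rewrite permM !tpermL.
have hj : h j = t by rewrite permM tpermR tpermD // eq_sym.
have scoreE b : score m r b = (s m)`_b + (s m)`_(h b).
  by rewrite !big_cons big_nil perm1 addr0.
have : split_total m r t j = split_total m r t t.
  apply: resistant_tie => // [b|]; rewrite !scoreE ht ?hj.
    have [->|bt] := eqVneq b t; first by rewrite ht.
    by rewrite (const b) // (const k) // addrC lerD2r.
  by rewrite (const j) // (const k) // addrC.
by rewrite !big_cons !big_nil !perm1 !addr0 ht hj => ->.
Qed.

(** At q = 1 the alternative x keeps its position. With position 0 singled out and k = 1, the tie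
    identity becomes v_0 + v_1 = v_(j+1) + v_0, where v is [s m.+1]. *)
Lemma resistant_first m : q = 1 -> (1 < m < mbar)%N ->
  (forall j, (0 < j < m)%N -> (s m)`_j = (s m)`_1) ->
  (s m)`_1 < (s m)`_0 ->
  (forall j, (0 < j < m.+1)%N -> (s m.+1)`_j = (s m.+1)`_1) /\
  (s m.+1)`_1 < (s m.+1)`_0.
Proof.
case: m => [|m] // q1 /andP[lt1 lt_m] const lt10.
set v := (s m.+2 : seq R).
have const' (i : 'I_m.+1) : i != ord0 -> (s m.+1)`_i = (s m.+1)`_1.
  by rewrite -val_eqE -lt0n => i0; rewrite const // i0 /=.
have special := resistant_special lt_m const' lt10.
have {}special j (jm : (0 < j < m.+1)%N) : v`_j.+1 < v`_0 /\ v`_1 = v`_j.+1.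
  have [j0 lt_jm] := andP jm.
  have [] := special (Ordinal lt_jm); first by rewrite -val_eqE /= -lt0n.
  rewrite /split_score /= gtn_eqF // /bump /= q1 => lt_v.
  move=> /(_ (Ordinal lt1) isT); rewrite /split_score /= /bump /= => eq_v.
  split; first by rewrite add1n in lt_v; lra.
  by rewrite ?add1n in eq_v *; lra.
split; last by have [] := special 1%N lt1; rewrite -/v => ? ->.
case=> [|[|j]] //= jm; have [] := special j.+1 jm; by rewrite -/v => _ <-.
Qed.

(** At q = 0 the alternative x drops below its clone. With the last position singled out, the tie
    identity becomes v_(k+1) = v_j for all j and k below m - 1, where v is [s m.+1]; this links all
    entries except the last. *)
Lemma resistant_last m : q = 0 -> (1 < m < mbar)%N ->
  (forall j, (j < m.-1)%N -> (s m)`_j = (s m)`_0) ->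
  (s m)`_0 < (s m)`_m.-1 ->
  (forall j, (j < m)%N -> (s m.+1)`_j = (s m.+1)`_0) /\
  (s m.+1)`_0 < (s m.+1)`_m.
Proof.
case: m => [|m] //= q0 /andP[lt1 lt_m] const lt0m.
set v := (s m.+2 : seq R).
have const' (i : 'I_m.+1) : i != ord_max -> (s m.+1)`_i = (s m.+1)`_0.
  by rewrite -val_eqE /= => im; rewrite const // ltn_neqAle im -ltnS /=.
have special := resistant_special lt_m const' lt0m.
have {}special j k (jm : (j < m)%N) (km : (k < m)%N) :
    v`_j < v`_m.+1 /\ v`_k.+1 = v`_j.
  have [] := special (Ordinal (leqW jm : (j < m.+1)%N)).
    by rewrite -val_eqE /= ltn_eqF.
  rewrite /split_score /= eqxx ltn_eqF // /bump leqNgt jm q0 => lt_v.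
  move=> /(_ (Ordinal (leqW km : (k < m.+1)%N))) /=.
  rewrite -val_eqE /= ltn_eqF // eqxx gtn_eqF // (ltnW km) => /(_ isT) eq_v.
  split; first by rewrite add0n in lt_v; lra.
  by rewrite add0n add1n in eq_v; lra.
have m0 : (0 < m)%N := lt1.
split=> [j|].
  rewrite ltnS leq_eqVlt => /orP[/eqP->|jm].
    by have [|_ <-] := special 0%N m.-1 m0; rewrite ?prednK.
  by have [_ <-] := special j 0%N jm m0; have [_ <-] := special 0%N 0%N m0 m0.
by have [] := special _ _ m0 m0.
Qed.

Lemma resistant_trivial : (s 2)`_0 = (s 2)`_1 ->
  forall m, (0 < m <= mbar)%N -> forall j, (j < m)%N -> (s m)`_j = (s m)`_0.
Proof.
move=> eq01; case=> [|m] // /andP[_]; case: m => [|m]; first by move=> _ [].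
elim: m => [_ [|[|]] //|m IH lt_m j lt_j].
by apply: resistant_const => // k; apply: IH; apply: ltnW.
Qed.

Lemma resistant_plurality : q = 1 -> (s 2)`_1 < (s 2)`_0 ->
  forall m, (1 < m <= mbar)%N ->
  (forall j, (0 < j < m)%N -> (s m)`_j = (s m)`_1) /\ (s m)`_1 < (s m)`_0.
Proof.
move=> q1 lt10; case=> [|[|m]] //; elim: m => [_|m IH lt_m].
  by split=> // -[|[|]].
by have [] := IH (ltnW lt_m); apply: resistant_first.
Qed.

Lemma resistant_inverse_plurality : q = 0 -> (s 2)`_0 < (s 2)`_1 ->
  forall m, (1 < m <= mbar)%N ->
  (forall j, (j < m.-1)%N -> (s m)`_j = (s m)`_0) /\ (s m)`_0 < (s m)`_m.-1.
Proof.
move=> q0 lt01; case=> [|[|m]] //; elim: m => [_|m IH lt_m].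
  by split=> // -[|[|]].
by have [] := IH (ltnW lt_m); apply: resistant_last.
Qed.

End Necessity.

(** * Equivalence of score vectors as equations and inequalities *)

Section Uses.
Variables (R : realType) (s : forall m : nat, m.-tuple R).

Lemma usesP m (v : m.-tuple R) :
  uses s v <-> exists lam c : R, 0 < lam /\
    forall j, (j < m)%N -> (s m)`_j = lam * v`_j + c.
Proof.
split=> -[lam [c [lam0 sE]]]; exists lam, c; split=> // j.
  by move=> jm; have := sE (Ordinal jm); rewrite !(tnth_nth 0).
by rewrite !(tnth_nth 0) sE.
Qed.

(** In dimension two only the sign of the difference survives equivalence; the quotient is the
    scaling factor. *)
Lemma uses_pair (a b : R) : a != b ->
  uses s [tuple a; b] <-> 0 < ((s 2)`_0 - (s 2)`_1) / (a - b).
Proof.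
rewrite -subr_eq0 => ab; rewrite usesP; split=> [[lam [c [lam0 sE]]]|lam0].
  by rewrite !sE //= (_ : _ / _ = lam) //; field.
exists (((s 2)`_0 - (s 2)`_1) / (a - b)).
exists ((s 2)`_0 - ((s 2)`_0 - (s 2)`_1) / (a - b) * a).
split=> // -[|[|//]] _ /=.
  by ring.
by field.
Qed.

Lemma uses_10 : uses s [tuple 1; 0] <-> (s 2)`_1 < (s 2)`_0.
Proof. by rewrite uses_pair ?oner_eq0 // subr0 divr1 subr_gt0. Qed.

Lemma uses_01 : uses s [tuple 0; 1] <-> (s 2)`_0 < (s 2)`_1.
Proof.
rewrite uses_pair 1?eq_sym ?oner_eq0 // sub0r invrN invr1 mulrN1 opprB.
by rewrite subr_gt0.
Qed.

Lemma uses_1t0 (t : R) : uses s [tuple 1; t; 0] <->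
  (s 3)`_2 < (s 3)`_0 /\ (s 3)`_1 = t * (s 3)`_0 + (1 - t) * (s 3)`_2.
Proof.
rewrite usesP; split=> [[lam [c [lam0 sE]]]|[lt_s mid]].
  by rewrite !sE //=; split; [lra | ring].
exists ((s 3)`_0 - (s 3)`_2), (s 3)`_2; rewrite subr_gt0; split=> //.
by case=> [|[|[|//]]] _ /=; rewrite ?mid; ring.
Qed.

Lemma uses_0t1 (t : R) : uses s [tuple 0; t; 1] <->
  (s 3)`_0 < (s 3)`_2 /\ (s 3)`_1 = (1 - t) * (s 3)`_0 + t * (s 3)`_2.
Proof.
rewrite usesP; split=> [[lam [c [lam0 sE]]]|[lt_s mid]].
  by rewrite !sE //=; split; [lra | ring].
exists ((s 3)`_2 - (s 3)`_0), (s 3)`_0; rewrite subr_gt0; split=> //.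
by case=> [|[|[|//]]] _ /=; rewrite ?mid; ring.
Qed.

Lemma uses_mktuple m (f : 'I_m -> R) :
  uses s [tuple f i | i < m] <-> exists lam c : R, 0 < lam /\
    forall i : 'I_m, (s m)`_i = lam * f i + c.
Proof.
by split=> -[lam [c [lam0 sE]]]; exists lam, c; split=> // i;
  have := sE i; rewrite tnth_mktuple (tnth_nth 0).
Qed.

Lemma is_trivialP mbar : is_trivial mbar s <->
  forall m, (0 < m <= mbar)%N -> forall j, (j < m)%N -> (s m)`_j = (s m)`_0.
Proof.
split=> triv m le_m => [j jm|].
  have [c /uses_mktuple [lam [d [_ sE]]]] := triv m le_m.
  rewrite (sE (Ordinal jm)).
  by rewrite (sE (Ordinal (leq_ltn_trans (leq0n j) jm))).
exists 0; apply/uses_mktuple; exists 1, (s m)`_0; split=> // i.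
by rewrite mulr0 add0r triv.
Qed.

Lemma is_pluralityP mbar : is_plurality mbar s <->
  forall m, (1 < m <= mbar)%N ->
  (forall j, (0 < j < m)%N -> (s m)`_j = (s m)`_1) /\ (s m)`_1 < (s m)`_0.
Proof.
split=> plur m le_m; have /andP[lt1 _] := le_m.
  have /uses_mktuple [lam [c [lam0 sE]]] := plur m le_m.
  have sE' j : (0 < j < m)%N -> (s m)`_j = c.
    case/andP=> j0 jm; rewrite (sE (Ordinal jm)) /= gtn_eqF //.
    by rewrite mulr0 add0r.
  split=> [j jm|]; first by rewrite sE' // [RHS]sE'.
  rewrite sE' // (sE (Ordinal (ltnW lt1))) /=; lra.
have [const lt10] := plur m le_m.
apply/uses_mktuple; exists ((s m)`_0 - (s m)`_1), (s m)`_1.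
rewrite subr_gt0; split=> // -[[|j] jm] /=; first by ring.
by rewrite const // mulr0 add0r.
Qed.

Lemma is_inverse_pluralityP mbar : is_inverse_plurality mbar s <->
  forall m, (1 < m <= mbar)%N ->
  (forall j, (j < m.-1)%N -> (s m)`_j = (s m)`_0) /\ (s m)`_0 < (s m)`_m.-1.
Proof.
split=> plur m le_m; have /andP[lt1 _] := le_m;
  have m0 : (0 < m.-1)%N by rewrite -ltnS prednK // ltnW.
  have /uses_mktuple [lam [c [lam0 sE]]] := plur m le_m.
  have sE' j : (j < m.-1)%N -> (s m)`_j = c.
    move=> jm; rewrite (sE (Ordinal (leq_trans jm (leq_pred m)))) /= ltn_eqF //.
    by rewrite mulr0 add0r.
  have lt_m : (m.-1 < m)%N by rewrite prednK // ltnW.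
  split=> [j jm|]; first by rewrite sE' // [RHS]sE'.
  by rewrite sE' // (sE (Ordinal lt_m)) /= eqxx mulr1 ltrDr.
have [const lt0m] := plur m le_m.
apply/uses_mktuple; exists ((s m)`_m.-1 - (s m)`_0), (s m)`_0.
rewrite subr_gt0; split=> // -[j jm] /=.
have [->|jm1] := eqVneq j m.-1; first by rewrite ?eqxx mulr1 subrK.
rewrite const ?mulr0 ?add0r // ltn_neqAle jm1 -ltnS prednK //; exact: ltnW.
Qed.

End Uses.

(** * Resistance of the listed rules *)

Section Sufficiency.
Variables (R : realType) (V X : choiceType) (p : rat) (mbar : nat).
Variable s : forall m : nat, m.-tuple R.

Lemma trivial_resistant : is_trivial mbar s ->
  clone_resistant p (positional_rule V X mbar s).
Proof.
move/is_trivialP=> triv; apply: clone_resistant_affine => m /andP[m0 lt_m].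
have trivS := triv m.+1 lt_m.
have trivm : forall j, (j < m)%N -> (s m)`_j = (s m)`_0.
  by apply: triv; rewrite m0 ltnW.
have trivk k : (k < m)%N ->
    (s m.+1)`_k = (s m.+1)`_0 /\ (s m.+1)`_k.+1 = (s m.+1)`_0.
  by move=> km; split; apply: trivS; lia.
exists 1, (fun=> (s m.+1)`_0 - (s m)`_0); split=> [//|k j km jm|k km].
  rewrite trivm // /split_score; case: eqP => _; last first.
    by rewrite trivS; [ring | rewrite /bump; lia].
  by have [-> ->] := trivk k km; ring.
have [sk sk1] := trivk k km.
by rewrite /clone_score /split_score eqxx sk sk1; lra.
Qed.

(** At p = 1 the holder of the first position keeps it under any cloning and no other old
    alternative reaches it, so the split scores take the two plurality values whatever the position
    of x. *)
Lemma plurality_resistant : p = 1 -> is_plurality mbar s ->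
  clone_resistant p (positional_rule V X mbar s).
Proof.
move=> p1 /is_pluralityP plur.
apply: clone_resistant_affine => m /andP[m0 lt_m].
have [constS ltS] : (forall j, (0 < j < m.+1)%N -> (s m.+1)`_j = (s m.+1)`_1)
    /\ (s m.+1)`_1 < (s m.+1)`_0 by apply: plur; rewrite ltnS m0.
have splitE k j : (k < m)%N -> (j < m)%N -> split_score (ratr p) (s m.+1) k j
    = if j == 0%N then (s m.+1)`_0 else (s m.+1)`_1.
  move=> km jm; rewrite /split_score p1 rmorph1 subrr mul0r mul1r addr0.
  case: (eqVneq j k) => [->|jk]; case: eqP => j0; first by rewrite j0.
  - by apply: constS; lia.
  - by rewrite (_ : bump _ _ = 0%N) // /bump; lia.
  - by apply: constS; rewrite /bump; lia.
have cloneE k : (k < m)%N -> clone_score (ratr p) (s m.+1) k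
    <= split_score (ratr p) (s m.+1) k k.
  move=> km; rewrite splitE // /clone_score p1 rmorph1.
  rewrite (constS k.+1) //.
  by case: eqP => _; lra.
(* A one-entry vector has no gap to rescale, so slope 1 is used for m = 1; otherwise the slope is
   the ratio of the two gaps. *)
have [m1|m_gt1] : m = 1%N \/ (1 < m)%N by lia.
  exists 1, (fun=> (s m.+1)`_0 - (s m)`_0); split=> // k j km jm.
  have -> : j = 0%N by lia.
  by rewrite splitE //=; ring.
have [constm lt10] : (forall j, (0 < j < m)%N -> (s m)`_j = (s m)`_1)
    /\ (s m)`_1 < (s m)`_0 by apply: plur; rewrite m_gt1 ltnW.
pose lam := ((s m.+1)`_0 - (s m.+1)`_1) / ((s m)`_0 - (s m)`_1).
have lamE : lam * ((s m)`_0 - (s m)`_1) = (s m.+1)`_0 - (s m.+1)`_1.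
  by rewrite divfK // gt_eqF // subr_gt0.
exists lam, (fun=> (s m.+1)`_0 - lam * (s m)`_0).
split=> [|k j km jm|//]; first by rewrite divr_gt0 // subr_gt0.
rewrite splitE //; case: eqP => [->|j0]; first by ring.
by rewrite constm; [lra | lia].
Qed.

(** At p = 0 the holder of the last position still ends last, even when it is x, which then falls
    below its clone. *)
Lemma inverse_plurality_resistant : p = 0 -> is_inverse_plurality mbar s ->
  clone_resistant p (positional_rule V X mbar s).
Proof.
move=> p0 /is_inverse_pluralityP plur.
apply: clone_resistant_affine => m /andP[m0 lt_m].
have [constS ltS] : (forall j, (j < m)%N -> (s m.+1)`_j = (s m.+1)`_0)
    /\ (s m.+1)`_0 < (s m.+1)`_m by apply: (plur m.+1); rewrite ltnS m0.
have splitE k j : (k < m)%N -> (j < m)%N -> split_score (ratr p) (s m.+1) k j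
    = if j == m.-1 then (s m.+1)`_m else (s m.+1)`_0.
  move=> km jm; rewrite /split_score p0 rmorph0 subr0 mul0r mul1r add0r.
  case: (eqVneq j k) => [->|jk]; case: eqP => j1.
  - by rewrite j1 prednK.
  - by apply: constS; lia.
  - by rewrite (_ : bump _ _ = m) // /bump; lia.
  - by apply: constS; rewrite /bump; lia.
have cloneE k : (k < m)%N -> clone_score (ratr p) (s m.+1) k
    <= split_score (ratr p) (s m.+1) k k.
  move=> km; rewrite splitE // /clone_score p0 rmorph0 (constS k km).
  by case: eqP => _; lra.
have [m1|m_gt1] : m = 1%N \/ (1 < m)%N by lia.
  exists 1, (fun=> (s m.+1)`_m - (s m)`_0); split=> // k j km jm.
  have j0 : j = 0%N by lia.
  by rewrite splitE // j0 m1 /=; ring.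
have [constm lt0m] :
    (forall j, (j < m.-1)%N -> (s m)`_j = (s m)`_0) /\ (s m)`_0 < (s m)`_m.-1.
  by apply: plur; rewrite m_gt1 ltnW.
pose lam := ((s m.+1)`_m - (s m.+1)`_0) / ((s m)`_m.-1 - (s m)`_0).
have lamE : lam * ((s m)`_m.-1 - (s m)`_0) = (s m.+1)`_m - (s m.+1)`_0.
  by rewrite divfK // gt_eqF // subr_gt0.
exists lam, (fun=> (s m.+1)`_m - lam * (s m)`_m.-1).
split=> [|k j km jm|//]; first by rewrite divr_gt0 // subr_gt0.
rewrite splitE //; case: eqP => [->|j1]; first by ring.
by rewrite constm; [lra | lia].
Qed.

(** The positive factor [mu] expresses that both vectors have the same orientation, which treats
    increasing and decreasing vectors at once. The sign condition keeps the clone from outscoring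
    x. *)
Lemma three_resistant (mu : R) : mbar = 3%N -> 0 <= p <= 1 -> 0 < mu ->
  (s 3)`_0 - (s 3)`_2 = mu * ((s 2)`_0 - (s 2)`_1) ->
  (s 3)`_1 = (1 - ratr p) * (s 3)`_0 + ratr p * (s 3)`_2 ->
  0 <= (2 * ratr p - 1) * ((s 2)`_0 - (s 2)`_1) ->
  clone_resistant p (positional_rule V X mbar s).
Proof.
move=> mbar3 /andP[p0 p1] mu0 endsE mid le_pair.
apply: clone_resistant_affine => m; rewrite mbar3.
have q0 : 0 <= ratr p :> R by rewrite ler0q.
have q1 : ratr p <= 1 :> R by rewrite -(rmorph1 (@ratr R)) ler_rat.
set q : R := ratr p in q0 q1 mid le_pair *.
case: m => [|[|[|]]] // _.
  exists 1, (fun k => split_score q (s 2) k 0 - (s 1)`_0).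
  split=> // [[|] [|]|[|]] // _; first by move=> _; ring.
  rewrite /clone_score /split_score /=; lra.
have q2 : 0 < (q - 1 / 2) ^+ 2 + 3 / 4 by have := sqr_ge0 (q - 1 / 2); lra.
pose lam := ((q - 1 / 2) ^+ 2 + 3 / 4) * mu.
have lamE : lam * ((s 2)`_0 - (s 2)`_1)
    = ((q - 1 / 2) ^+ 2 + 3 / 4) * ((s 3)`_0 - (s 3)`_2).
  by rewrite endsE mulrA.
have le_ends : 0 <= (2 * q - 1) * ((s 3)`_0 - (s 3)`_2).
  by rewrite endsE mulrCA mulr_ge0 // ltW.
(* This offset makes j = 0 immediate. For j = 1, the gap between the two split scores is 1 - q + q^2
   times v_0 - v_2 for both k, with v the vector [s 3]. *)
exists lam, (fun k => split_score q (s 3) k 0 - lam * (s 2)`_0).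
split=> [|[|[|//]] [|[|//]] _ _|]; first by rewrite mulr_gt0.
- by ring.
- rewrite /split_score /= /bump /= addn1 mid; lra.
- by ring.
- rewrite /split_score /= /bump /= addn0 mid; lra.
(* The lead of x over its clone is (2q - 1)(v_k - v_(k+1)), and the value of the middle entry turns
   the last factor into q or 1 - q times v_0 - v_2. *)
case=> [|[|//]] _; rewrite /clone_score /split_score /= mid.
  by have := mulr_ge0 q0 le_ends; lra.
have q1' : 0 <= 1 - q by rewrite subr_ge0.
by have := mulr_ge0 q1' le_ends; lra.
Qed.

End Sufficiency.

(** * The characterizations for three alternatives, for four or more, and for p = 1 and p = 0 *)

Theorem theorem2 (R : realType) (V X : choiceType)
    (infV : infinite_set [set: V]%classic) (infX : infinite_set [set: X]%classic)
    (p : rat) (hp : 0 <= p <= 1) (mbar : nat) (hmbar : (3 <= mbar)%N)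
    (s : forall m : nat, m.-tuple R) :
  let F : social_choice_rule V X mbar := positional_rule V X mbar s in
  [/\ mbar = 3%N ->
        (clone_resistant p F <->
           [\/ is_trivial mbar s,
               [/\ 1 / 2 < p, uses s [tuple 1; 0]
                 & uses s [tuple 1; 1 - ratr p; 0]],
               p = 1 / 2 /\
                 ((uses s [tuple 1; 0] /\ uses s [tuple 1; 1 / 2; 0]) \/
                  (uses s [tuple 0; 1] /\ uses s [tuple 0; 1 / 2; 1]))
             | [/\ p < 1 / 2, uses s [tuple 0; 1]
                 & uses s [tuple 0; ratr p; 1]]]),
      (4 <= mbar)%N -> 0 < p < 1 ->
        (clone_resistant p F <-> is_trivial mbar s),
      clone_resistant 1 F <-> (is_plurality mbar s \/ is_trivial mbar s)
    & clone_resistant 0 F <-> (is_inverse_plurality mbar s \/ is_trivial mbar s)].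
Proof.
move=> F; have lt1 : (1 < mbar)%N := ltnW hmbar.
have half : ratr (1 / 2) = 1 / 2 :> R by rewrite fmorph_div rmorph1 rmorph_nat.
have triv01 q : 0 <= q <= 1 -> clone_resistant q F -> (s 2%N)`_0 = (s 2%N)`_1 ->
    is_trivial mbar s.
  move=> q01 resF eq01; apply/is_trivialP.
  exact: (resistant_trivial infV infX q01 resF eq01).
split.
- move=> mbar3; split=> [resF|].
    have pairE : 0 <= (2 * ratr p - 1) * ((s 2%N)`_0 - (s 2%N)`_1).
      by have := resistant_pair infV infX hp resF lt1; lra.
    have [lt01|lt10|eq01] := ltgtP (s 2%N)`_0 (s 2%N)`_1; last first.
    + by apply: Or41; apply: triv01 resF eq01.
    + have neq01 : (s 2%N)`_0 != (s 2%N)`_1 by rewrite gt_eqF.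
      have mid := resistant_middle infV infX hp resF hmbar neq01.
      have [ends _] := resistant_ends infV infX hp resF hmbar neq01.
      rewrite lt10 in ends.
      have [lt_p|lt_p|eq_p] := ltgtP p (1 / 2).
      * move: lt_p; rewrite -(ltr_rat R) half => lt_p; exfalso.
        by move: pairE; rewrite pmulr_lge0 ?subr_gt0 //; lra.
      * apply: Or42; split=> //; first exact/uses_10.
        by apply/uses_1t0; rewrite ends mid; split=> //; ring.
      * apply: Or43; split=> //; left; split; first exact/uses_10.
        by apply/uses_1t0; rewrite ends mid eq_p half; split=> //; field.
    + have neq01 : (s 2%N)`_0 != (s 2%N)`_1 by rewrite lt_eqF.
      have mid := resistant_middle infV infX hp resF hmbar neq01.
      have [_ ends] := resistant_ends infV infX hp resF hmbar neq01.
      rewrite lt01 in ends.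
      have [lt_p|lt_p|eq_p] := ltgtP p (1 / 2).
      * apply: Or44; split=> //; first exact/uses_01.
        by apply/uses_0t1; rewrite ends mid.
      * move: lt_p; rewrite -(ltr_rat R) half => lt_p; exfalso.
        by move: pairE; rewrite nmulr_lge0 ?subr_lt0 //; lra.
      * apply: Or43; split=> //; right; split; first exact/uses_01.
        by apply/uses_0t1; rewrite ends mid eq_p half; split=> //; field.
  (* Two differences of the same strict sign have a positive quotient, which serves as the factor
     [mu] for both orientations. *)
  have ratio_gt0 (a b c d : R) : 0 < (a - b) * (c - d) ->
      0 < (a - b) / (c - d) /\ a - b = (a - b) / (c - d) * (c - d).
    move=> abcd; have cd0 : c - d != 0.
      by apply: contraTneq abcd => ->; rewrite mulr0 ltxx.
    split; last by rewrite divfK.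
    by rewrite -(pmulr_lgt0 _ (_ : 0 < (c - d) ^+ 2)) ?exprn_even_gt0 //;
      rewrite expr2 mulrA divfK.
  have three : 0 < ((s 3%N)`_0 - (s 3%N)`_2) * ((s 2%N)`_0 - (s 2%N)`_1) ->
      (s 3%N)`_1 = (1 - ratr p) * (s 3%N)`_0 + ratr p * (s 3%N)`_2 ->
      0 <= (2 * ratr p - 1) * ((s 2%N)`_0 - (s 2%N)`_1) -> clone_resistant p F.
    by move=> /ratio_gt0[mu0 muE]; apply: three_resistant mu0 muE.
  case=> [|[lt_p /uses_10 lt_u /uses_1t0 [lt_v mid]]
         |[p_half [[/uses_10 lt_u /uses_1t0 [lt_v mid]]
                  |[/uses_01 lt_u /uses_0t1 [lt_v mid]]]]
         |[lt_p /uses_01 lt_u /uses_0t1 [lt_v mid]]].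
  + exact: trivial_resistant.
  + apply: three; first by rewrite mulr_gt0 ?subr_gt0.
      by rewrite mid; ring.
    move: lt_p; rewrite -(ltr_rat R) half => lt_p.
    by rewrite mulr_ge0 ?subr_ge0 ?ltW //; lra.
  + apply: three; first by rewrite mulr_gt0 ?subr_gt0.
      by rewrite mid p_half half; field.
    by rewrite p_half half (_ : _ - 1 = 0) ?mul0r //; lra.
  + apply: three; first by rewrite nmulr_rgt0 ?subr_lt0.
      by rewrite mid p_half half.
    by rewrite p_half half (_ : _ - 1 = 0) ?mul0r //; lra.
  + apply: three => //; first by rewrite nmulr_rgt0 ?subr_lt0.
    move: lt_p; rewrite -(ltr_rat R) half => lt_p.
    by rewrite nmulr_rge0 ?subr_le0 ?ltW //; lra.
- move=> lt3 /andP[p0 p1]; split=> [resF|]; last exact: trivial_resistant.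
  have [eq01|neq01] := eqVneq (s 2%N)`_0 (s 2%N)`_1.
    exact: triv01 resF eq01.
  have mid := resistant_middle infV infX hp resF hmbar neq01.
  have q01 : 0 < (ratr p : R) < 1.
    by rewrite ltr0q p0 -(rmorph1 (@ratr R)) ltr_rat.
  (* Equal end scores for three alternatives contradict the strict comparison transferred from a
     nonconstant [s 2]. *)
  have eq02 := resistant_three infV infX hp resF lt3 q01 mid.
  have [end1 end2] := resistant_ends infV infX hp resF hmbar neq01.
  rewrite eq02 ltxx in end1 end2.
  by case: ltgtP neq01 end1 end2.
- have p01 : 0 <= (1 : rat) <= 1 by rewrite ler01 lexx.
  split=> [resF|[plur|]]; last exact: trivial_resistant; last first.
    exact: plurality_resistant.
  (* At p = 1 this says that the second score of [s 2] is at most the first, so only plurality and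
     constancy remain. *)
  have := resistant_pair infV infX p01 resF lt1.
  rewrite (rmorph1 (@ratr R)) subrr !mul0r !mul1r add0r addr0 => le_pair.
  have [lt01|lt10|eq01] := ltgtP (s 2%N)`_0 (s 2%N)`_1.
  + by move: le_pair; rewrite leNgt lt01.
  + left; apply/is_pluralityP.
    exact: (resistant_plurality infV infX p01 resF (rmorph1 _) lt10).
  + by right; apply: triv01 resF eq01.
- have p01 : 0 <= (0 : rat) <= 1 by rewrite ler01 lexx.
  split=> [resF|[plur|]]; last exact: trivial_resistant; last first.
    exact: inverse_plurality_resistant.
  (* At p = 0 the inequality is reversed, leaving inverse plurality and constancy. *)
  have := resistant_pair infV infX p01 resF lt1.
  rewrite (rmorph0 (@ratr R)) subr0 !mul0r !mul1r add0r addr0 => le_pair.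
  have [lt01|lt10|eq01] := ltgtP (s 2%N)`_0 (s 2%N)`_1.
  + left; apply/is_inverse_pluralityP.
    exact: (resistant_inverse_plurality infV infX p01 resF (rmorph0 _) lt01).
  + by move: le_pair; rewrite leNgt lt10.
  + by right; apply: triv01 resF eq01.
Qed.
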